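(* Consider the linear-quadratic dynamic game $\mathcal{G}_\infty^{\mathrm{LQ}}$ and its system-level best-response maps $BR_\Phi^p$ ($p\in\mathcal{P}$), $BR_\Phi$, as described in the context. Let $\Phi_u^\star=(\Phi_u^{1\star},\dots,\Phi_u^{N_P\star})\in\mathcal{C}_u^1\times\cdots\times\mathcal{C}_u^{N_P}$ and let $\Phi_x^\star=F_\Phi\Phi_u^\star$ be the associated state response. If $\Phi_u^\star\in BR_\Phi(\Phi_u^\star)$, or, equivalently, $$\Phi_u^{p\star}\in BR_\Phi^p(\Phi_u^{-p\star})\quad\text{for all }p\in\mathcal{P},$$ then the policy profile $K^\star=(K^{1\star},\dots,K^{N_P\star})\in\mathcal{C}$, with $K^{p\star}=\Phi_u^{p\star}(\Phi_x^\star)^{-1}$, is a generalized feedback Nash equilibrium of $\mathcal{G}_\infty^{\mathrm{LQ}}$.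
   Context: **Game.** Players $\mathcal{P}=\{1,\dots,N_P\}$. State dynamics $x_{t+1}=Ax_t+\sum_{p\in\mathcal{P}}B^pu_t^p+w_t$, $x_t\in\mathbb{R}^{N_x}$, $u_t^p\in\mathbb{R}^{N_u^p}$. The noise is zero-mean and white with covariance $\Sigma_w\succ0$, and $w_t\in\mathcal{W}\subseteq\mathbb{R}^{N_x}$ for all $t$ (write $w\in\boldsymbol{\mathcal{W}}$); the initial condition is treated as part of the disturbance. A superscript $-p$ denotes the tuple of all players' objects except player $p$'s. Player $p$ has the quadratic objective $J^p(u^p,u^{-p})=\mathrm{E}\big[\sum_{t\ge0}(\|C^px_t\|_2^2+\|\sum_{\tilde p\in\mathcal{P}}D^{p\tilde p}u_t^{\tilde p}\|_2^2)\big]$. Standing assumptions, for each $p$: $(A,B^p)$ is stabilisable, $(C^p,A)$ is detectable, $D^{pp}$ has full column rank, $(D^{p\tilde p})^{\mathsf T}C^p=0$ for all $\tilde p$. The sets $\mathcal{X}\subseteq\mathbb{R}^{N_x}$, $\mathcal{U}^p\subseteq\mathbb{R}^{N_u^p}$, $\mathcal{U}_{\mathcal{G}}\subseteq\prod_p\mathbb{R}^{N_u^p}$ are convex polyhedra with $0$ in their relative interiors. Given $u^{-p}$, the set $U^p(u^{-p})$ consists of the plans $u^p$ such that, for all $w\in\boldsymbol{\mathcal{W}}$ and all $t$: $u_t^p\in\mathcal{U}^p$, $(u_t^p,u_t^{-p})\in\mathcal{U}_{\mathcal{G}}$, and the resulting state satisfies $x_t\in\mathcal{X}$. **Policies and responses.**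 Players use state feedback $u^p=K^px$, with $K^p$ a linear causal convolution operator in a prescribed set $\mathcal{C}^p$; $\mathcal{C}=\prod_p\mathcal{C}^p$. Under a stabilising profile the closed-loop signals are $x=\Phi_x*w$, $u^p=\Phi_u^p*w$, with strictly causal stable kernels $\Phi_x=(\Phi_{x,n})_{n\ge1}$, $\Phi_u^p=(\Phi_{u,n}^p)_{n\ge1}$ (transfer matrices in $\frac1z\mathcal{RH}_\infty$) satisfying $$\Phi_{x,n+1}=A\Phi_{x,n}+\sum_{p}B^p\Phi_{u,n}^p,\qquad\Phi_{x,1}=I_{N_x}.\quad(\ast)$$ $F_\Phi$ denotes the affine map $\Phi_u=(\Phi_u^1,\dots,\Phi_u^{N_P})\mapsto\Phi_x$ defined by $(\ast)$. Conversely, $K^p=\Phi_u^p\Phi_x^{-1}$ denotes the operator with transfer matrix $\hat\Phi_u^p\hat\Phi_x^{-1}$. The sets of kernels $\mathcal{C}_x,\mathcal{C}_u^p$ are designed to encode the policy constraint: $\mathcal{C}_u^p=\{K^p\Phi_x:K^p\in\mathcal{C}^p,\Phi_x\in\mathcal{C}_x\}$, and $K^p=\Phi_u^p\Phi_x^{-1}\in\mathcal{C}^p$ is enforced by $\Phi_x\in\mathcal{C}_x$, $\Phi_u^p\in\mathcal{C}_u^p$. **Costs.** The objective of a closed-loop plan $u=\Phi_u*w$ is identified with the system-level functional $$J^p(\Phi_u^p,\Phi_u^{-p})=\sum_{n\ge1}\Big(\|C^p\Phi_{x,n}\Sigma_w^{1/2}\|_F^2+\Big\|\sum_{\tilde p}D^{p\tilde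 p}\Phi_{u,n}^{\tilde p}\Sigma_w^{1/2}\Big\|_F^2\Big),\qquad\Phi_x=F_\Phi\Phi_u.$$ **System-level best response.** $BR_\Phi^p(\Phi_u^{-p})=\arg\min J^p(\Phi_u^p,\Phi_u^{-p})$ over $\Phi_u^p\in\mathcal{C}_u^p$ such that $\Phi_x=F_\Phi(\Phi_u^p,\Phi_u^{-p})\in\mathcal{C}_x$ and, for all $w\in\boldsymbol{\mathcal{W}}$ and all $n$, $(\Phi_x*w)_n\in\mathcal{X}$, $(\Phi_u^p*w)_n\in\mathcal{U}^p$, $((\Phi_u^p*w)_n,(\Phi_u^{-p}*w)_n)\in\mathcal{U}_{\mathcal{G}}$. $BR_\Phi(\Phi_u)=BR_\Phi^1(\Phi_u^{-1})\times\cdots\times BR_\Phi^{N_P}(\Phi_u^{-N_P})$. **Generalized feedback Nash equilibrium (GFNE).** A (stabilising) profile $K^\star\in\mathcal{C}$, with closed-loop signals $x^\star$ and $u^{p\star}=K^{p\star}x^\star$, is a GFNE if for every $p$: $u^{p\star}\in U^p(u^{-p\star})$ and $J^p(u^{p\star},u^{-p\star})\le J^p(u^p,u^{-p\star})$ for every $u^p\in U^p(u^{-p\star})$. Here the other players' plans $u^{-p\star}=\Phi_u^{-p\star}*w$ are held fixed, and the competing plans $u^p$ are those with a stabilising feedback representation $u^p=K^px$, $K^p\in\mathcal{C}^p$, where $x$ is the state generated by $(u^p,u^{-p\star})$.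
   Formalization: The encoding of the policy constraint is assumed exact: for stable responses with opponents' kernels in C_u^q, K^p=Φ_u^pΦ_x^{-1} lies in C^p if and only if Φ_x∈C_x and Φ_u^p∈C_u^p; with only the ''enforced by'' direction the claim is false. *)

(* Defs.v *)
From HB Require Import structures.
From mathcomp Require Import all_boot all_order all_algebra.
From mathcomp Require Import complex.
From mathcomp Require Import all_classical all_reals all_analysis.

Set Implicit Arguments.
Unset Strict Implicit.
Unset Printing Implicit Defensive.

Import Order.TTheory GRing.Theory Num.Theory.
Import numFieldNormedType.Exports.

Local Open Scope classical_set_scope.
Local Open Scope ring_scope.

Section Matrices.
Variable R : realType.

(* All complex eigenvalues lie in the open unit disc. *)
Definition schur n (M : 'M[R]_n) : Prop :=
  forall l : R[i], eigenvalue (map_mx (real_complex R) M) l -> `|l| < 1.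

Definition stabilisable n m (A : 'M[R]_n) (B : 'M[R]_(n, m)) : Prop :=
  exists F : 'M[R]_(m, n), schur (A + B *m F).

Definition detectable n k (C : 'M[R]_(k, n)) (A : 'M[R]_n) : Prop :=
  exists L : 'M[R]_(n, k), schur (A + L *m C).

Definition possemidef n (M : 'M[R]_n) : Prop :=
  M^T = M /\ forall v : 'cV[R]_n, 0 <= (v^T *m M *m v) 0 0.

Definition posdef n (M : 'M[R]_n) : Prop :=
  M^T = M /\ forall v : 'cV[R]_n, v != 0 -> 0 < (v^T *m M *m v) 0 0.

(* The unique positive semidefinite square root of M; the default value 0 is
   only taken when M is not positive semidefinite. *)
Definition sqrtmx n (M : 'M[R]_n) : 'M[R]_n :=
  xget 0 [set S | possemidef S /\ S *m S = M].

Definition frobenius_sq m n (M : 'M[R]_(m, n)) : R :=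
  \sum_i \sum_j M i j ^+ 2.

Definition polyhedron n (S : set 'cV[R]_n) : Prop :=
  exists (m : nat) (H : 'M[R]_(m, n)) (h : 'cV[R]_m),
    S = [set x | forall i, (H *m x) i 0 <= h i 0].

Definition affine_hull n (S : set 'cV[R]_n) : set 'cV[R]_n :=
  [set y | exists (k : nat) (c : 'I_k -> R) (s : 'I_k -> 'cV[R]_n),
     [/\ forall i, S (s i), \sum_i c i = 1 & y = \sum_i c i *: s i]].

Definition relative_interior n (S : set 'cV[R]_n) : set 'cV[R]_n :=
  [set x | S x /\ \forall y \near x, affine_hull S y -> S y].

End Matrices.

Section Kernels.
Variable R : realType.

(* A convolution kernel (f_n)_{n >= 0}, identified with the transfer matrix
   \sum_n f_n z^{-n}. *)
Definition kernel (m n : nat) := nat -> 'M[R]_(m, n).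

(* Signals are indexed by t >= 0 and are kernels with one column, so that the
   same convolution also gives the action of a kernel on a signal. *)
Definition signal (n : nat) := kernel n 1.

Definition conv m n k (f : kernel m n) (g : kernel n k) : kernel m k :=
  fun t => \sum_(i < t.+1) f i *m g (t - i)%N.

(* a is the impulse response of a proper real rational transfer function with
   all its poles in the open unit disc: with l = 1/z, one has
   \sum_n a_n l^n = num(l) / den(l), where den has no root with |l| <= 1. *)
Definition RHinfty (a : nat -> R) : Prop :=
  exists num den : {poly R},
    (forall l : R[i], `|l| <= 1 -> ~~ root (map_poly (real_complex R) den) l) /\
    (forall n, \sum_(k < n.+1) den`_k * a (n - k)%N = num`_n).

(* Transfer matrix in (1/z) RH_infinity. *)
Definition stable m n (f : kernel m n) : Prop :=
  f 0%N = 0 /\ forall i j, RHinfty (fun t => f t i j).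

(* For strictly causal F, G with G_1 invertible, quot F G is the causal kernel
   with transfer matrix F(z) G(z)^{-1}: comparing the coefficients of z^{-(n+1)}
   in K(z) G(z) = F(z) gives
   K_n G_1 = F_{n+1} - \sum_{i < n} K_i G_{n+1-i}.
   quot_seq F G n is the list [K_0; ...; K_{n-1}]. *)
Fixpoint quot_seq m n (F : kernel m n) (G : kernel n n) (k : nat) :
    seq 'M[R]_(m, n) :=
  if k is k'.+1 then
    let s := quot_seq F G k' in
    rcons s ((F k'.+1 - \sum_(i < k') nth 0 s i *m G (k'.+1 - i)%N)
             *m invmx (G 1%N))
  else [::].

Definition quot m n (F : kernel m n) (G : kernel n n) : kernel m n :=
  fun k => nth 0 (quot_seq F G k.+1) k.

Lemma size_quot_seq m n (F : kernel m n) (G : kernel n n) k :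
  size (quot_seq F G k) = k.
Proof. by elim: k => //= k IH; rewrite size_rcons IH. Qed.

Lemma nth_quot_seq m n (F : kernel m n) (G : kernel n n) k i :
  (i < k)%N -> nth 0 (quot_seq F G k) i = quot F G i.
Proof.
elim: k => // k IH; rewrite ltnS leq_eqVlt => /predU1P[-> //|ik].
by rewrite /= nth_rcons size_quot_seq ik IH.
Qed.

Lemma quotK m n (F : kernel m n) (G : kernel n n) :
  F 0%N = 0 -> G 0%N = 0 -> G 1%N \in unitmx -> conv (quot F G) G = F.
Proof.
move=> F0 G0 G1; apply/funext => -[|k].
  by rewrite /conv big_ord1 subn0 G0 mulmx0 F0.
rewrite /conv big_ord_recr /= subnn G0 mulmx0 addr0 big_ord_recr /= subSnn.
rewrite {2}/quot /= nth_rcons size_quot_seq ltnn eqxx mulmxKV//.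
rewrite addrCA (eq_bigr (fun i : 'I_k =>
  nth 0 (quot_seq F G k) i *m G (k.+1 - i)%N)) ?subrr ?addr0// => i _.
by rewrite nth_quot_seq.
Qed.

End Kernels.

(* Each w t is a square-integrable random vector with values in W; the family
   has zero mean, covariance Sigma and no correlation between distinct times. *)
Definition white_noise (R : realType) d (Omega : measurableType d)
    (P : probability Omega R) n (w : nat -> Omega -> 'cV[R]_n)
    (Sigma : 'M[R]_n) (W : set 'cV[R]_n) : Prop :=
  [/\ forall t i, (fun om => w t om i 0) \in Lfun P 2%:E,
      forall t i, ('E_P[fun om => w t om i 0%R] = 0)%E,
      forall s t i j,
        covariance P (fun om => w s om i 0) (fun om => w t om j 0)
        = (if s == t then Sigma i j else 0)%:E
    & forall t, {ae P, forall om, W (w t om)}].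

(* The disturbance w_0 carries the initial condition: trajectories start from
   x_0 = 0, whence x_1 = w_0. *)
Record lq_game (R : realType) := LQGame {
  nP : nat;
  nX : nat;
  nU : 'I_nP -> nat;
  nZ : 'I_nP -> nat;
  dynA : 'M[R]_nX;
  dynB : forall p, 'M[R]_(nX, nU p);
  costC : forall p, 'M[R]_(nZ p, nX);
  costD : forall p q, 'M[R]_(nZ p, nU q);
  Sigma_w : 'M[R]_nX;
  Wset : set 'cV[R]_nX;
  Xset : set 'cV[R]_nX;
  Uset : forall p, set 'cV[R]_(nU p);
  (* subset of \prod_p R^{nU p}, with the inputs stacked in one column *)
  UGset : set 'cV[R]_(\sum_p nU p);
  (* policy sets C^p, given by the causal kernels of the operators *)
  policies : forall p, set (kernel R (nU p) nX);
  Cx : set (kernel R nX nX)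
}.

Arguments Wset {R} l.
Arguments Xset {R} l.
Arguments Uset {R l} p.
Arguments UGset {R} l.
Arguments policies {R l} p.
Arguments Cx {R} l.

Section Game.
Variables (R : realType) (g : lq_game R).

Let P := 'I_(nP g).

Definition profile := forall p : P, kernel R (nU p) (nX g).

Definition standing_assumptions : Prop :=
  [/\ (0 < nP g)%N,
      forall p : P,
        [/\ stabilisable (dynA g) (dynB p), detectable (costC p) (dynA g),
            \rank (costD p p) = nU p
          & forall q, (costD p q)^T *m costC p = 0],
      [/\ polyhedron (Xset g) /\ relative_interior (Xset g) 0,
          forall p : P, polyhedron (Uset p) /\
                        relative_interior (Uset p) 0
        & polyhedron (UGset g) /\ relative_interior (UGset g) 0],
      posdef (Sigma_w g)
    & Cx g `<=` [set F | stable F]].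

(* A map from disturbance sequences to input sequences of player p. *)
Definition plan (p : P) := signal R (nX g) -> signal R (nU p).

Definition disturbance : set (signal R (nX g)) :=
  [set w | forall t, Wset g (w t)].

Fixpoint state (u : forall p, plan p) (w : signal R (nX g)) (t : nat) :
    'cV[R]_(nX g) :=
  if t is s.+1 then
    dynA g *m state u w s + \sum_(p : P) dynB p *m u p w s + w s
  else 0.

(* U^p(u^{-p}); the p-th component of u is irrelevant. *)
Definition feasible_plans (p : P) (u : forall q, plan q) : set (plan p) :=
  [set v | forall w, disturbance w -> forall t,
     [/\ Uset p (v w t),
         UGset g (\mxcol_q dfwith u p v q w t)
       & Xset g (state (dfwith u p v) w t)]].
Arguments feasible_plans p u : clear implicits.

Definition plan_of (Phi_u : profile) (p : P) : plan p :=
  fun w => conv (Phi_u p) w.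

Fixpoint F_Phi (Phi_u : profile) (n : nat) : 'M[R]_(nX g) :=
  match n with
  | 0 => 0
  | 1 => 1%:M
  | m.+1 => dynA g *m F_Phi Phi_u m + \sum_(p : P) dynB p *m Phi_u p m
  end.

(* The set C_u^p of kernels K Phi_x with K in C^p and Phi_x in C_x. *)
Definition Cu (p : P) : set (kernel R (nU p) (nX g)) :=
  [set F | stable F /\
     exists K Phi_x, [/\ policies p K, Cx g Phi_x
                       & F = conv K Phi_x]].
Arguments Cu p : clear implicits.

(* C_x and C_u^p encode the constraint K^p \in C^p: for every stable response
   satisfying the closed-loop recursion in which the other players' kernels are
   admissible, Phi_u^p Phi_x^{-1} lies in C^p exactly when Phi_x lies in C_x
   and Phi_u^p lies in C_u^p. *)
Definition encodes_policies : Prop :=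
  forall (p : P) (Phi_u : profile),
    (forall q, stable (Phi_u q)) -> stable (F_Phi Phi_u) ->
    (forall q, q != p -> Cu q (Phi_u q)) ->
    policies p (quot (Phi_u p) (F_Phi Phi_u)) <->
    Cx g (F_Phi Phi_u) /\ Cu p (Phi_u p).

Definition cost (p : P) (Phi_u : profile) : \bar R :=
  (\sum_(1 <= n <oo)
     (frobenius_sq (costC p *m F_Phi Phi_u n *m sqrtmx (Sigma_w g))
      + frobenius_sq ((\sum_(q : P) costD p q *m Phi_u q n)
                      *m sqrtmx (Sigma_w g)))%:E)%E.

(* Feasible set of the best response of p to Phi_u^{-p}; the p-th component of
   Phi_u is irrelevant. *)
Definition BR_feasible (p : P) (Phi_u : profile) :
    set (kernel R (nU p) (nX g)) :=
  [set F | let Psi : profile := dfwith Phi_u p F in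
     [/\ Cu p F, Cx g (F_Phi Psi)
       & forall w, disturbance w -> forall n,
         [/\ Xset g (conv (F_Phi Psi) w n),
             Uset p (conv F w n)
           & UGset g (\mxcol_q conv (Psi q) w n)]]].
Arguments BR_feasible p Phi_u : clear implicits.

Definition BR_player (p : P) (Phi_u : profile) :
    set (kernel R (nU p) (nX g)) :=
  [set F | BR_feasible p Phi_u F /\
     forall F', BR_feasible p Phi_u F' ->
       (cost p (dfwith Phi_u p F) <= cost p (dfwith Phi_u p F'))%E].
Arguments BR_player p Phi_u : clear implicits.

Definition BR (Phi_u : profile) : set profile :=
  [set Psi | forall p, BR_player p Phi_u (Psi p)].

(* Under the feedback u^p = K^p x for all p, the closed-loop signals are
   x = Phi_x * w and u^p = Phi_u^p * w, with stable kernels. *)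
Definition stabilising_with (K : profile) (Phi_x : kernel R (nX g) (nX g))
    (Phi_u : profile) : Prop :=
  [/\ stable Phi_x, forall p, stable (Phi_u p)
    & forall w, state (plan_of Phi_u) w = conv Phi_x w /\
      forall p, plan_of Phi_u p w = conv (K p) (state (plan_of Phi_u) w)].

(* The plan conv F of player p, against the fixed plans of the others, has a
   stabilising representation u^p = K^p x with K^p in C^p, where x is the
   resulting state. *)
Definition feedback_plan (p : P) (u : forall q, plan q)
    (F : kernel R (nU p) (nX g)) : Prop :=
  let x := state (dfwith u p (conv F : plan p)) in
  stable F /\
  exists (K : kernel R (nU p) (nX g)) (Psi_x : kernel R (nX g) (nX g)),
    [/\ policies p K, stable Psi_x
      & forall w, x w = conv Psi_x w /\ conv F w = conv K (x w)].
Arguments feedback_plan p u F : clear implicits.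

Definition GFNE (K : profile) : Prop :=
  (forall p, policies p (K p)) /\
  exists (Phi_x : kernel R (nX g) (nX g)) (Phi_u : profile),
    stabilising_with K Phi_x Phi_u /\
    forall p : P,
      let u := plan_of Phi_u in
      feasible_plans p u (u p) /\
      forall F : kernel R (nU p) (nX g),
        feedback_plan p u F -> feasible_plans p u (conv F : plan p) ->
        (cost p Phi_u <= cost p (dfwith Phi_u p F))%E.

End Game.

Arguments feasible_plans {R g} p u.
Arguments Cu {R g} p.
Arguments BR_feasible {R g} p Phi_u.
Arguments BR_player {R g} p Phi_u.
Arguments feedback_plan {R g} p u F.

(* Main.v *)
From mathcomp Require Import all_boot all_order all_algebra.
From mathcomp Require Import all_classical all_reals all_analysis.
Require Import Defs.

(** Along a strictly causal profile the state is [F_Phi Phi_u * w], so plans,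
    trajectories and constraints can be exchanged with kernels. A deviation
    [F] of player p with a stabilising representation [F = K * Psi_x] has
    response [F_Phi (F, Phi_u^{-p}) = Psi_x], because a kernel is determined by
    its action on signals; and [K = F Psi_x^{-1}], because [Psi_x] starts with
    the identity. Hence [encodes_policies] makes every feasible deviation from
    the profile a competitor in the system-level best response. *)

Set Implicit Arguments.
Unset Strict Implicit.
Unset Printing Implicit Defensive.

Import GRing.Theory.

Local Open Scope classical_set_scope.
Local Open Scope ring_scope.

Section Convolution.
Variable R : realType.

(** Both sides sum [f j *m h (i - j) *m e (t - i)] over the triangle [j <= i <= t]; exchanging the
    sums and shifting [i] by [j] matches them. *)
Lemma convA m n k l (f : kernel R m n) (h : kernel R n k) (e : kernel R k l) :
  conv f (conv h e) = conv (conv f h) e.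
Proof.
apply/funext => t; rewrite /conv; apply/esym.
under eq_bigr => i _.
  rewrite (big_ord_widen t.+1 (fun j => f j *m h (i - j)%N)) ?ltn_ord//.
  rewrite mulmx_suml; over.
rewrite (exchange_big_dep xpredT)//=; apply: eq_bigr => j _.
rewrite mulmx_sumr.
pose E i := f j *m h (i - j)%N *m e (t - i)%N.
have jt : (j <= t)%N by rewrite -ltnS.
transitivity (\sum_(j <= i < t.+1) E i).
  by rewrite [RHS](big_nat_widenl _ 0)// big_mkord; apply: eq_bigl.
rewrite -[X in \sum_(X <= _ < _) _]add0n big_addn subSn// big_mkord.
by apply: eq_bigr => i _; rewrite /E addnK addnC subnDA mulmxA.
Qed.

(** A unit impulse at time 0 in coordinate [j] reads off column [j] of the kernel at every time. *)
Lemma conv_signal_inj m n (f h : kernel R m n) :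
  (forall w : signal R n, conv f w = conv h w) -> f = h.
Proof.
move=> fh; apply/funext => t; apply/matrixP => i j.
pose w : signal R n := fun s => if s is 0%N then delta_mx j 0 else 0.
have impulse (k : kernel R m n) : conv k w t = col j (k t).
  rewrite /conv big_ord_recr /= subnn big1 ?add0r ?colE// => s _.
  by have := ltn_ord s; rewrite -subn_gt0 /w; case: (t - s)%N => // r _;
    rewrite mulmx0.
by have /matrixP/(_ i 0) := congr1 (@^~ t) (fh w); rewrite !impulse !mxE.
Qed.

(** Coefficient [k.+1] of [conv K G] ends with [K k *m G 1], since [G 0 = 0]. The earlier terms are
    the ones [quot] subtracts, so inverting [G 1] recovers [K k]. *)
Lemma conv_quot_unique m n (K : kernel R m n) (G : kernel R n n) :
  G 0%N = 0 -> G 1%N \in unitmx -> quot (conv K G) G = K.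
Proof.
move=> G0 G1; apply/funext; elim/ltn_ind => k IH.
rewrite /quot /= nth_rcons size_quot_seq ltnn eqxx.
under eq_bigr => i _ do rewrite nth_quot_seq// IH//.
rewrite {1}/conv big_ord_recr /= subnn G0 mulmx0 addr0 big_ord_recr /= subSnn.
by rewrite addrAC subrr add0r mulmxK.
Qed.

End Convolution.

Section Responses.
Variables (R : realType) (g : lq_game R).

(** Since [Phi_u p 0 = 0], inputs do not react to the current [w t], which therefore enters the next
    state only with the coefficient [F_Phi Phi_u 1 = 1%:M]. The coefficients of older disturbances
    obey the recursion of [F_Phi]. *)
Lemma state_conv (Phi_u : profile g) (w : signal R (nX g)) :
  (forall p, Phi_u p 0%N = 0) ->
  state (plan_of Phi_u) w = conv (F_Phi Phi_u) w.
Proof.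
move=> Phi0; apply/funext; elim=> [|t IH].
  by rewrite /conv big_ord1 mul0mx.
have -> : conv (F_Phi Phi_u) w t.+1 =
    w t + \sum_(i < t) F_Phi Phi_u i.+2 *m w (t - i.+1)%N.
  by rewrite /conv !big_ord_recl mul0mx add0r subSS subn0 mul1mx.
have convS m (f : kernel R m (nX g)) : f 0%N = 0 ->
    conv f w t = \sum_(i < t) f i.+1 *m w (t - i.+1)%N.
  by move=> f0; rewrite /conv big_ord_recl f0 mul0mx add0r.
rewrite [LHS]/= IH convS// addrC mulmx_sumr; congr (_ + _).
under [X in _ + X]eq_bigr => p _ do rewrite /plan_of convS// mulmx_sumr.
rewrite exchange_big -big_split; apply: eq_bigr => i _.
rewrite -[F_Phi _ i.+2]/(dynA g *m F_Phi Phi_u i.+1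
                         + \sum_p dynB p *m Phi_u p i.+1).
rewrite mulmxDl mulmx_suml mulmxA; congr (_ + _).
by apply: eq_bigr => p _; rewrite mulmxA.
Qed.

Lemma plan_of_dfwith (Phi_u : profile g) p (F : kernel R (nU p) (nX g)) :
  plan_of (dfwith Phi_u p F : profile g) =
  dfwith (plan_of Phi_u) p (conv F : plan p).
Proof.
apply: functional_extensionality_dep => q; rewrite /plan_of.
by case: dfwithP => [|r pr]; rewrite ?dfwithin// dfwithout.
Qed.

Lemma dfwith_profile_id (Phi_u : profile g) p :
  dfwith Phi_u p (Phi_u p) = Phi_u.
Proof. by apply: functional_extensionality_dep => q; case: dfwithP. Qed.

Lemma feasible_plans_conv (Phi_u : profile g) p (F : kernel R (nU p) (nX g)) :
  let Psi : profile g := dfwith Phi_u p F in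
  (forall q, Psi q 0%N = 0) ->
  feasible_plans p (plan_of Phi_u) (conv F : plan p) <->
  (forall w, @disturbance R g w -> forall n,
     [/\ Xset g (conv (F_Phi Psi) w n), Uset p (conv F w n)
       & UGset g (\mxcol_q conv (Psi q) w n)]).
Proof.
move=> Psi Psi0; rewrite /feasible_plans /= -plan_of_dfwith.
by split=> H w Ww n; have := H w Ww n; rewrite state_conv// => -[].
Qed.

Lemma F_Phi_quot (Phi_u : profile g) p :
  Phi_u p 0%N = 0 ->
  conv (quot (Phi_u p) (F_Phi Phi_u)) (F_Phi Phi_u) = Phi_u p.
Proof. by move=> Phi0; rewrite quotK//= unitmx1. Qed.

Lemma feedback_BR_feasible (Phi_u : profile g) p (F : kernel R (nU p) (nX g)) :
  encodes_policies g -> (forall q, Cu q (Phi_u q)) ->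
  feedback_plan p (plan_of Phi_u) F ->
  feasible_plans p (plan_of Phi_u) (conv F : plan p) ->
  BR_feasible p Phi_u F.
Proof.
move=> henc hPhi [sF [K [Psi_x [KC sPsi_x repr]]]] feas.
pose Psi : profile g := dfwith Phi_u p F.
have Psip : Psi p = F by rewrite /Psi dfwithin.
have sPsi q : stable (Psi q).
  by rewrite /Psi; case: dfwithP => // r _; case: (hPhi r).
have Psi0 q : Psi q 0%N = 0 by case: (sPsi q).
have stE w : state (dfwith (plan_of Phi_u) p (conv F : plan p)) w =
    conv (F_Phi Psi) w by rewrite -plan_of_dfwith state_conv.
have PsiE : F_Phi Psi = Psi_x.
  by apply: conv_signal_inj => w; case: (repr w) => <- _; rewrite stE.
have FE : F = conv K (F_Phi Psi).
  apply: conv_signal_inj => w; case: (repr w) => _ ->.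
  by rewrite stE convA.
have KE : quot (Psi p) (F_Phi Psi) = K.
  by rewrite Psip FE conv_quot_unique//= unitmx1.
(* The encoding is read from policies to kernels. Its premises hold because the response is the
   stable [Psi_x] and the other players keep their kernels from [Phi_u]. *)
have [|||+ _] := henc p Psi _ _ _ => //; first by rewrite PsiE.
  by move=> q qp; rewrite /Psi dfwithout 1?eq_sym.
rewrite KE Psip => /(_ KC)[CxPsi CuF]; split=> //.
exact/feasible_plans_conv.
Qed.

End Responses.

Theorem theorem3 (R : realType) (d : measure_display) (Omega : measurableType d)
    (Pr : probability Omega R) (g : lq_game R)
    (noise : nat -> Omega -> 'cV[R]_(nX g))
    (hg : standing_assumptions g)
    (hnoise : white_noise Pr noise (Sigma_w g) (Wset g))
    (henc : encodes_policies g)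
    (Phi_u : profile g)
    (hPhi : forall p, Cu p (Phi_u p)) :
  let Phi_x := F_Phi Phi_u in
  let K : profile g := fun p => quot (Phi_u p) Phi_x in
  (BR Phi_u Phi_u <-> forall p, BR_player p Phi_u (Phi_u p)) /\
  (BR Phi_u Phi_u -> GFNE K).
Proof.
move=> Phi_x K; split=> // br.
have [nP_gt0 _ _ _ Cx_stable] := hg.
have sPhi p : stable (Phi_u p) by case: (hPhi p).
have Phi0 p : Phi_u p 0%N = 0 by case: (sPhi p).
have CxPhi : Cx g Phi_x.
  (* Any one player's feasibility gives [Cx g Phi_x], the response being common to all; a player
     exists because [0 < nP g]. *)
  by have [[_ + _] _] := br (Ordinal nP_gt0); rewrite dfwith_profile_id.
have sPhi_x : stable Phi_x := Cx_stable _ CxPhi.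
(* Here the encoding is read from kernels to policies. *)
split=> [p|]; first by apply/(henc p Phi_u) => //; split.
exists Phi_x, Phi_u; split.
  split=> // w; rewrite state_conv//; split=> // p.
  by rewrite convA F_Phi_quot.
move=> p u; have [[_ _ feas] opt] := br p; split.
  by apply/feasible_plans_conv => // q; rewrite dfwith_profile_id.
move=> F fbF feasF; rewrite -{1}(dfwith_profile_id Phi_u p).
by apply: opt; apply: feedback_BR_feasible.
Qed.
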